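(* Let $\mathbf{B}=(B;\vee,\wedge,{}',0,1)$ be a Boolean algebra, let $S$ be the set of all Boolean algebra homomorphisms $\mathbf B\to\mathbf 2$ (where $\mathbf 2$ is the two-element Boolean algebra $\{0,1\}$), and identify each $b\in B$ with the map $S\to\{0,1\}$, $g\mapsto b(g):=g(b)$ (so $\mathbf B$ is a Boolean subalgebra of $2^{S}$). Let $C\subseteq B$ with $1\in C$ such that $a,b\in C$ implies $a\wedge b\in C$, and let $X$ be a non-empty set. For each $x\in X$ let $T_x\colon C\to 2^{S}$ be a map preserving finite meets (i.e. $T_x(a\wedge b)=T_x(a)\wedge T_x(b)$ for $a,b\in C$) with $T_x(1)=1$, and put $T=(T_x)_{x\in X}$. Define, for each $x\in X$, $$R_{T_x}=\{(s,t)\in S\times S\mid \forall c\in C:\ T_x(c)(s)\le c(t)\},$$ let $R_T=\bigcup_{x\in X}\{x\}\times R_{T_x}$ (so $(X,S,R_T)$ is the upper $T$-induced automaton), and let $T_{R_T}=((T_{R_T})_x)_{x\in X}\colon B\to (2^{S})^X$ be given by $(T_{R_T})_x(b)(s)=\bigwedge\{b(t)\mid (s,t)\in R_{T_x}\}$ (empty meet $=1$). Then for all $b\in C$ and all $x\in X$, $T_x(b)=(T_{R_T})_x(b)$, i.e. $T(b)=T_{R_T}(b)$.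
   Context: $2^{S}$ denotes the set of maps $S\to\{0,1\}$ with pointwise order and operations; $p(s)$ denotes the value of such a map $p$ at $s$. *)

(* Defs.v *)
From HB Require Import structures.
From mathcomp Require Import all_boot all_order.
From mathcomp Require Import boolp classical_sets.

Set Implicit Arguments.
Unset Strict Implicit.
Unset Printing Implicit Defensive.

Import Order.TTheory.
Local Open Scope classical_set_scope.

(* A Boolean algebra is a [ctbDistrLatticeType]; the one-element algebra is
   allowed, and then there is no homomorphism to [bool].  The library's
   [{tblmorphism B -> bool}] only requires that \bot and \top be preserved, hence
   the explicit record. *)
Record bool_hom (d : Order.disp_t) (B : ctbDistrLatticeType d) := BoolHom {
  bool_hom_fun :> B -> bool;
  bool_homU : {morph bool_hom_fun : a b / (a `|` b)%O};
  bool_homI : {morph bool_hom_fun : a b / (a `&` b)%O};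
  bool_homC : {morph bool_hom_fun : a / (~` a)%O};
  bool_hom0 : bool_hom_fun \bot%O = \bot%O;
  bool_hom1 : bool_hom_fun \top%O = \top%O
}.

(* The identification of b with the map g |-> g(b).  The order and meet of
   [bool_hom B -> bool] are the pointwise ones of boolp's FunOrder. *)
Definition evaluation (d : Order.disp_t) (B : ctbDistrLatticeType d) (b : B) :
    bool_hom B -> bool :=
  fun g => g b.

(* Top and binary meet of the subset C, viewed as a type. *)
Definition sub_top (d : Order.disp_t) (B : ctbDistrLatticeType d) (C : set B)
    (C1 : C \top%O) : C :=
  SigSub (mem_set C1).

Definition sub_meet (d : Order.disp_t) (B : ctbDistrLatticeType d) (C : set B)
    (CI : forall a b : B, C a -> C b -> C (a `&` b)%O) (a b : C) : C :=
  SigSub (mem_set (CI _ _ (set_mem (valP a)) (set_mem (valP b)))).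

Definition upper_rel (d : Order.disp_t) (B : ctbDistrLatticeType d) (C : set B)
    (Tx : C -> bool_hom B -> bool) : set (bool_hom B * bool_hom B) :=
  [set st | forall c : C, (Tx c st.1 <= evaluation (val c) st.2)%O].

Definition upper_transition (d : Order.disp_t) (B : ctbDistrLatticeType d)
    (C : set B) (X : Type) (T : X -> C -> bool_hom B -> bool) :
    set (X * (bool_hom B * bool_hom B)) :=
  \bigcup_(x in [set: X]) ([set x] `*` upper_rel (T x)).

(* The default value \top of [infimum] is the meet of the empty set. *)
Definition transition_op (d : Order.disp_t) (B : ctbDistrLatticeType d)
    (X : Type) (R : set (X * (bool_hom B * bool_hom B))) (x : X) (b : B) :
    bool_hom B -> bool :=
  fun s => infimum \top%O [set evaluation b t | t in [set t | R (x, (s, t))]].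

(* The x-section of R_T is R_{T_x}. *)
Lemma upper_transitionE (d : Order.disp_t) (B : ctbDistrLatticeType d)
    (C : set B) (X : Type) (T : X -> C -> bool_hom B -> bool) (x : X)
    (s t : bool_hom B) :
  upper_transition T (x, (s, t)) = upper_rel (T x) (s, t).
Proof.
apply/propext; split=> [[y _ [/= -> //]]|h].
by exists x.
Qed.

Lemma transition_op_upperE (d : Order.disp_t) (B : ctbDistrLatticeType d)
    (C : set B) (X : Type) (T : X -> C -> bool_hom B -> bool) (x : X) (b : B)
    (s : bool_hom B) :
  transition_op (upper_transition T) x b s
  = infimum \top%O
      [set evaluation b t | t in [set t | upper_rel (T x) (s, t)]].
Proof.
rewrite /transition_op; congr (infimum _ [set _ | _ in _]).
by apply/funext => t /=; rewrite upper_transitionE.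
Qed.

(* Every subset of [bool] has an infimum, so [infimum] is the true meet. *)
Lemma infimum_boolE (A : set bool) :
  infimum \top%O A = `[< forall v, A v -> v >].
Proof.
rewrite /infimum; case: ifPn => [/eqP ->|/set0P[v Av]].
  by symmetry; apply/asboolP.
have inf : infimums A `[< forall v, A v -> v >].
  split=> [w Aw|w lw].
    by case: asboolP => [/(_ w Aw) ->|_] //; case: w {Aw}.
  case: w lw => [lw|_]; last by [].
  suff -> : `[< forall v, A v -> v >] = true by [].
  by apply/asboolP => u /lw; case: u.
by case: xgetP => [w _ /is_subset1_infimums -/(_ _ inf)|/(_ _ inf)].
Qed.

(* Main.v *)
(** Only [T_{R_T}(b) <= T(b)] has content.  If [T_x(b)(s) = 0], the elements of
    [B] above some [c] in [C] with [T_x(c)(s) = 1] form a filter, because [T_x]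
    preserves finite meets, and this filter omits [b], because [T_x] is monotone.
    A filter containing it and maximal among those omitting [b] is an
    ultrafilter; its indicator function is a homomorphism [t] with
    [(s, t) \in R_{T_x}] and [b(t) = 0]. *)
Require Import Defs.
From HB Require Import structures.
From mathcomp Require Import all_boot all_order.
From mathcomp Require Import boolp classical_sets.

Set Implicit Arguments.
Unset Strict Implicit.
Unset Printing Implicit Defensive.

Import Order.Theory.
Local Open Scope classical_set_scope.

Record lattice_filter (d : Order.disp_t) (L : tMeetSemilatticeType d)
    (F : set L) : Prop := LatticeFilter {
  lattice_filter1 : F \top%O;
  lattice_filterI : forall a b, F a -> F b -> F (a `&` b)%O;
  lattice_filterS : forall a b, (a <= b)%O -> F a -> F b
}.

Section Filters.
Variables (d : Order.disp_t) (L : tMeetSemilatticeType d).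
Implicit Types (F G : set L) (a b : L).

(** For a filter [G], this is the filter generated by [G] and [a]. *)
Definition filter_adjoin G a : set L :=
  [set c | exists2 g, G g & (g `&` a <= c)%O].

Lemma lattice_filter_adjoin G a :
  lattice_filter G -> lattice_filter (filter_adjoin G a).
Proof.
case=> G1 GI GS; split; first by exists \top%O; rewrite ?lex1.
- move=> c c' [g Gg gc] [g' Gg' gc']; exists (g `&` g')%O; first exact: GI.
  (* Duplicating [a] lets each of [g] and [g'] be paired with its own copy. *)
  by rewrite -(meetxx a) meetACA leI2.
- by move=> c c' cc' [g Gg gc]; exists g => //; apply: le_trans cc'.
Qed.

Lemma sub_filter_adjoin G a : G `<=` filter_adjoin G a.
Proof. by move=> c Gc; exists c => //; apply: leIl. Qed.

Lemma mem_filter_adjoin G a : lattice_filter G -> filter_adjoin G a a.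
Proof. by case=> G1 _ _; exists \top%O; rewrite ?leIr. Qed.

Lemma maximal_filter_avoiding F b : lattice_filter F -> ~ F b ->
  exists G, [/\ lattice_filter G, F `<=` G, ~ G b &
    forall H, lattice_filter H -> G `<=` H -> ~ H b -> H `<=` G].
Proof.
move=> fF Fb.
(* The union with [F] lets the empty chain be bounded as well. *)
pose P A := lattice_filter (F `|` A) /\ ~ (F `|` A) b.
have [K KP Ktot|A [[fG Gb] Amax]] := @Zorn_bigcup L P.
  have [[A0 KA0]|K0] := pselect (exists A, K A); last first.
    rewrite /P (_ : \bigcup_(X in K) X = set0) ?setU0 //.
    by apply/seteqP; split=> // c [X KX _]; apply: K0; exists X.
  have memK c : (F `|` \bigcup_(X in K) X) c ->
      exists2 X, K X & (F `|` X) c.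
    by case=> [Fc|[X KX Xc]]; [exists A0 => //; left|exists X => //; right].
  have subK X : K X -> F `|` X `<=` F `|` \bigcup_(Y in K) Y.
    by move=> KX c [Fc|Xc]; [left|right; exists X].
  split; last by move=> /memK[X /KP[]].
  split; first by left; apply: lattice_filter1 fF.
  - move=> c c' /memK[X KX Xc] /memK[Y KY Yc'].
    case: (Ktot _ _ KX KY) => [XY|YX].
      apply: (subK _ KY); have [fY _] := KP _ KY.
      by apply: (lattice_filterI fY) => //; apply: setUS Xc.
    apply: (subK _ KX); have [fX _] := KP _ KX.
    by apply: (lattice_filterI fX) => //; apply: setUS Yc'.
  - move=> c c' cc' /memK[X KX Xc]; apply: (subK _ KX); have [fX _] := KP _ KX.
    exact: (lattice_filterS fX cc').
exists (F `|` A); split=> // H fH GH Hb c Hc.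
(* A point of [H] outside [F] and [A] would make [H] a proper extension of [A] that still satisfies
   [P], against the maximality of [A]. *)
apply: contrapT => Gc; apply: (Amax H); last first.
  by rewrite /P (_ : F `|` H = H) //; apply/setUidPr => a Fa; apply: GH; left.
split=> [a Aa|HA]; first by apply: GH; right.
by apply: Gc; right; apply: HA.
Qed.

End Filters.

Section Ultrafilters.
Variables (d : Order.disp_t) (B : ctbDistrLatticeType d).
Implicit Types (F G : set B) (a b : B).

(** If [G] contained neither [a] nor its complement, maximality would force [b] into both adjoined
    filters. Two elements of [G], one met with [a] and the other with its complement, would then lie
    below [b]; by distributivity so would their meet, which puts [b] in [G]. *)
Lemma maximal_filter_avoiding_ultra G b :
    lattice_filter G -> ~ G b ->
    (forall H, lattice_filter H -> G `<=` H -> ~ H b -> H `<=` G) ->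
  forall a, G a \/ G (~` a)%O.
Proof.
move=> fG Gb Gmax a; apply: contrapT => /not_orP[Ga GCa].
have adjoinP c : ~ G c -> filter_adjoin G c b.
  move=> Gc; apply: contrapT => nb; apply: Gc.
  apply: (Gmax (filter_adjoin G c)) => //; last exact: mem_filter_adjoin.
    exact: lattice_filter_adjoin.
  exact: sub_filter_adjoin.
have [g Gg ga] := adjoinP _ Ga; have [g' Gg' ga'] := adjoinP _ GCa.
apply: Gb; apply: (lattice_filterS fG _ (lattice_filterI fG Gg Gg')).
rewrite -[X in (X <= _)%O]meetx1 -(joinxC a) meetUr leUx; apply/andP; split.
  by apply: le_trans ga; apply: leI2 => //; apply: leIl.
by apply: le_trans ga'; apply: leI2 => //; apply: leIr.
Qed.

Lemma bool_hom_ultrafilter G :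
    lattice_filter G -> ~ G \bot%O -> (forall a, G a \/ G (~` a)%O) ->
  exists t : bool_hom B, forall a, t a = `[< G a >].
Proof.
move=> fG G0 Gu.
have GI a b : G (a `&` b)%O <-> G a /\ G b.
  split=> [Gab|[]]; last exact: lattice_filterI.
  by split; apply: (lattice_filterS fG _ Gab); rewrite ?leIl ?leIr.
have GC a : G (~` a)%O <-> ~ G a.
  split=> [GCa Ga|]; last by case: (Gu a).
  by apply: G0; rewrite -(meetxC a); apply/GI.
pose f a := `[< G a >].
have fI : {morph f : a b / (a `&` b)%O}.
  by move=> a b; apply/asboolP/andP => [/GI[? ?]|[/asboolP ? /asboolP ?]];
    [split; apply/asboolP|apply/GI].
have fC : {morph f : a / (~` a)%O}.
  by move=> a; apply/asboolP/negP => [/GC ? /asboolP //|Ga]; apply/GC => /asboolP.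
(* Joins reduce to meets and complements by De Morgan. *)
have fU : {morph f : a b / (a `|` b)%O}.
  by move=> a b; rewrite -[(a `|` b)%O]complK complU fC fI !fC complI !complK.
have f0 : f \bot%O = \bot%O by apply/asboolPn.
have f1 : f \top%O = \top%O by apply/asboolP; apply: lattice_filter1 fG.
by exists (BoolHom fU fI fC f0 f1).
Qed.

Lemma bool_hom_separation F b : lattice_filter F -> ~ F b ->
  exists t : bool_hom B, (forall a, F a -> t a) /\ ~~ t b.
Proof.
move=> fF Fb; have [G [fG FG Gb Gmax]] := maximal_filter_avoiding fF Fb.
(* A filter that omits [b] is proper, since it would otherwise contain everything above [\bot]. *)
have G0 : ~ G \bot%O by move/(lattice_filterS fG (le0x b)).
have [t tE] := bool_hom_ultrafilter fG G0 (maximal_filter_avoiding_ultra fG Gb Gmax).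
by exists t; split=> [a /FG Ga|]; rewrite tE; [apply/asboolP|apply/asboolPn].
Qed.

End Ultrafilters.

Theorem theorem5 (d : Order.disp_t) (B : ctbDistrLatticeType d) (C : set B)
    (C1 : C \top%O) (CI : forall a b : B, C a -> C b -> C (a `&` b)%O)
    (X : Type) (X0 : inhabited X)
    (T : X -> C -> bool_hom B -> bool)
    (TI : forall (x : X) (a b : C),
        T x (sub_meet CI a b) = (T x a `&` T x b)%O)
    (T1 : forall x : X, T x (sub_top C1) = (fun _ : bool_hom B => \top%O)) :
  forall (b : C) (x : X),
    T x b = transition_op (upper_transition T) x (val b).
Proof.
(* The easy inequality comes first: the relation, taken at [b] itself, bounds [T x b s] by every
   value in the meet. *)
move=> b x; apply/funext => s; rewrite transition_op_upperE infimum_boolE.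
apply/idP/asboolP => [Tbs _ [t st <-]|Rb].
  by move: (st b); rewrite /= Tbs; case: evaluation.
apply: contrapT => Tbs.
have TIs a c : T x (sub_meet CI a c) s = T x a s && T x c s by rewrite TI.
pose F := [set a : B | exists2 c : C, T x c s & (val c <= a)%O].
have fF : lattice_filter F.
  split.
  - by exists (sub_top C1); rewrite ?T1 ?lex1.
  - move=> a a' [c Tc ca] [c' Tc' ca']; exists (sub_meet CI c c').
      by rewrite TIs Tc Tc'.
    exact: leI2.
  - by move=> a a' aa' [c Tc ca]; exists c => //; apply: le_trans aa'.
have Fb : ~ F (val b).
  move=> [c Tc cb]; apply: Tbs.
  (* Monotonicity of [T x] on [C], obtained from meets: [c] below [b] means that their meet is
     [c]. *)
  have cbE : sub_meet CI c b = c by apply: val_inj; apply/meet_idPl.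
  by move: Tc; rewrite -cbE TIs => /andP[].
have [t [Ft /negP]] := bool_hom_separation fF Fb; apply; apply: Rb.
(* The pair of [s] and [t] lies in the relation: every [c] with [T x c s] true belongs to [F], where
   [t] is true. So [Rb] makes [t] true at [b], a contradiction. *)
exists t => //= c; rewrite /evaluation /=.
by case: (boolP (T x c s)) => // Tc; rewrite Ft //; exists c.
Qed.
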